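(* Let $L:[0,1]\to[0,1]$ be a genuine Lorenz curve, and let $p_0=n_0/n$ be the proportion of zeros in a dataset of size $n\ge 1$ containing $n_0$ zeros, where $0\le n_0<n$. Then the function $L_0$ defined by $$L_0(p)=\begin{cases}0, & 0\le p\le p_0,\\[4pt] \dfrac{L(p)-L(p_0)}{1-L(p_0)}, & p_0\le p\le 1,\end{cases}$$ is a genuine Lorenz curve.
   Context: A genuine Lorenz curve is a function $L:[0,1]\to[0,1]$ satisfying $L(0)=0$, $L(1)=1$, and which is nondecreasing and convex on $[0,1]$. *)

(* Defs.v *)
From mathcomp Require Import all_boot all_order all_algebra.
From mathcomp Require Import all_classical all_reals all_analysis.

Set Implicit Arguments.
Unset Strict Implicit.
Unset Printing Implicit Defensive.

Import Order.TTheory GRing.Theory Num.Theory.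

Local Open Scope classical_set_scope.
Local Open Scope ring_scope.

(* A function on [0, 1] is represented by a total function on R; the values
   outside [0, 1] are irrelevant, every clause being relative to [0, 1]. *)
Definition genuine_lorenz (R : realType) (L : R -> R) : Prop :=
  [/\ set_fun `[0, 1] `[0, 1] L,
      L 0 = 0,
      L 1 = 1,
      {in `[0, 1] &, {homo L : p q / p <= q}} &
      convex_function (`[0, 1] : set R^o) (L : R^o -> R^o)].

(* The two cases overlap at p = p0, where they agree: see [lorenz0_le] and
   [lorenz0_ge]. *)
Definition lorenz0 (R : realType) (L : R -> R) (p0 : R) (p : R) : R :=
  if p <= p0 then 0 else (L p - L p0) / (1 - L p0).

Lemma lorenz0_le (R : realType) (L : R -> R) (p0 p : R) :
  p <= p0 -> lorenz0 L p0 p = 0.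
Proof. by rewrite /lorenz0 => ->. Qed.

Lemma lorenz0_ge (R : realType) (L : R -> R) (p0 p : R) :
  p0 <= p -> lorenz0 L p0 p = (L p - L p0) / (1 - L p0).
Proof.
rewrite /lorenz0; case: ifP => // pp0 p0p.
have -> : p = p0 by apply/le_anti; rewrite pp0 p0p.
by rewrite subrr mul0r.
Qed.

(* Main.v *)
Require Import Defs.
From mathcomp Require Import all_boot all_order all_algebra.
From mathcomp Require Import all_classical all_reals all_analysis.
From mathcomp Require Import ring lra.

Import Order.TTheory GRing.Theory Num.Theory.

Local Open Scope ring_scope.

(** Since [L] is nondecreasing, on [0, 1] the two-piece formula for [lorenz0]
    is the positive part of the single function
    [M p = (L p - L p0) / (1 - L p0)] (lemma [lorenz0_max]).  Convexity of
    [L] puts its graph below the chord from (0, 0) to (1, 1), so [L p0 <= p0]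
    and the denominator [1 - L p0] is positive as soon as [p0 < 1] (lemma
    [genuine_lorenz_lt1]).  Hence [M] is a nondecreasing affine image of [L],
    with [M 1 = 1]; both monotonicity and convexity pass from [L] to [M], and
    then to the maximum of [M] and the constant 0. *)

Lemma convex_function_max (R : realFieldType) (E : lmodType R)
    (D : set (convex_lmodType E)) (f g : convex_lmodType E -> R^o) :
  convex_function D f -> convex_function D g ->
  convex_function D (fun x => Num.max (f x) (g x)).
Proof.
move=> cf cg t x y xD yD; rewrite ge_max !convRE.
have := cf t x y xD yD; have := cg t x y xD yD; rewrite !convRE => ley lex.
have t0 : 0 <= t%:num by [].
have s0 : 0 <= unstable.onem t%:num by rewrite subr_ge0.
apply/andP; split; [apply: le_trans lex _|apply: le_trans ley _];
  by apply: lerD; apply: ler_wpM2l => //; rewrite le_max lexx ?orbT.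
Qed.

Lemma convex_function_subM (R : realFieldType) (E : lmodType R)
    (D : set (convex_lmodType E)) (f : convex_lmodType E -> R^o) (c k : R) :
  0 <= k -> convex_function D f ->
  convex_function D (fun x => (f x - c) * k : R^o).
Proof.
move=> k0 cf t x y xD yD; have := cf t x y xD yD.
rewrite !convRE /unstable.onem => fxy.
have -> : t%:num * ((f x - c) * k) + (1 - t%:num) * ((f y - c) * k) =
  (t%:num * f x + (1 - t%:num) * f y - c) * k :> R by ring.
by apply: ler_wpM2r => //; apply: lerB.
Qed.

Lemma convex_function_cst (R : realFieldType) (E : lmodType R)
    (D : set (convex_lmodType E)) (c : R) :
  convex_function D (fun=> c : R^o).
Proof. by move=> t x y _ _; rewrite convmm. Qed.

Lemma conv01 (R : realType) (t : {i01 R}) (x y : R^o) :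
  x \in `[0, 1] -> y \in `[0, 1] -> conv t x y \in `[0, 1].
Proof.
rewrite !in_itv /= convRE => /andP[x0 x1] /andP[y0 y1].
have t0 : 0 <= t%:num by [].
have t1 : t%:num <= 1 by [].
by rewrite /unstable.onem; apply/andP; split; nra.
Qed.

(** A point [p] of [0, 1] is the convex combination of 1 and 0 with weight [p],
    and [L] fixes both of these endpoints. *)
Lemma genuine_lorenz_le_diag (R : realType) (L : R -> R) (p : R) :
  genuine_lorenz L -> p \in `[0, 1] -> L p <= p.
Proof.
case=> _ L0 L1 _ cL; rewrite in_itv /= => /andP[p0 p1].
have in01 (x : R) : 0 <= x <= 1 -> x \in `[0, 1]%classic.
  by rewrite inE /= in_itv.
have := cL (Itv01 p0 p1) (1 : R^o) (0 : R^o).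
(* The combination is taken in [convex_lmodType R^o], whose operation is only
   convertible to the one that [convRE] rewrites. *)
have -> : conv (Itv01 p0 p1) (1 : convex_lmodType R^o) (0 : R^o) = p.
  by have := convRE (1 : R^o) 0 (Itv01 p0 p1); rewrite mulr0 addr0 mulr1.
rewrite convRE /= L0 L1 mulr0 addr0 mulr1; apply;
  by apply: in01; rewrite lexx ler01.
Qed.

Lemma genuine_lorenz_lt1 (R : realType) (L : R -> R) (p : R) :
  genuine_lorenz L -> 0 <= p -> p < 1 -> L p < 1.
Proof.
move=> hL p0 p1; apply: le_lt_trans (p1); apply: genuine_lorenz_le_diag => //.
by rewrite in_itv /= p0 ltW.
Qed.

(** Monotonicity makes [L p - L p0] nonpositive to the left of [p0] and
    nonnegative to the right, which selects the branch of the maximum. *)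
Lemma lorenz0_max (R : realType) (L : R -> R) (p0 p : R) :
  genuine_lorenz L -> 0 <= p0 -> p0 < 1 -> p \in `[0, 1] ->
  lorenz0 L p0 p = Num.max 0 ((L p - L p0) / (1 - L p0)).
Proof.
move=> hL p00 p01 pI; have L1 := genuine_lorenz_lt1 _ _ _ hL p00 p01.
have p0I : p0 \in `[0, 1] by rewrite in_itv /= p00 ltW.
case: hL => _ _ _ mL _.
have d0 : 0 <= (1 - L p0)^-1 by rewrite invr_ge0 subr_ge0 ltW.
have [pp0|/ltW p0p] := leP p p0.
- rewrite lorenz0_le // max_l // mulr_le0_ge0 // subr_le0.
  by apply: mL.
- rewrite lorenz0_ge // max_r // mulr_ge0 // subr_ge0.
  by apply: mL.
Qed.

(** The convexity part applies [convex_function_max] to the constant 0 and [M];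
    [conv01] keeps the convex combination in the range where [lorenz0_max]
    rewrites [lorenz0] as this maximum. *)
Lemma lorenz0_genuine (R : realType) (L : R -> R) (p0 : R) :
  genuine_lorenz L -> 0 <= p0 -> p0 < 1 -> genuine_lorenz (lorenz0 L p0).
Proof.
move=> hL p00 p01; have lt1 := genuine_lorenz_lt1 _ _ _ hL p00 p01.
have maxE p := lorenz0_max R L p0 p hL p00 p01.
case: (hL) => _ L0 L1 mL cL.
have d0 : 0 <= (1 - L p0)^-1 by rewrite invr_ge0 subr_ge0 ltW.
have I0 : (0 : R) \in `[0, 1] by rewrite in_itv /= lexx ler01.
have I1 : (1 : R) \in `[0, 1] by rewrite in_itv /= lexx ler01.
have mL0 : {in `[0, 1] &, {homo lorenz0 L p0 : p q / p <= q}}.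
  move=> p q pI qI pq; rewrite !maxE // ge_max le_max lexx /= le_max.
  by apply/orP; right; rewrite ler_wpM2r // lerB // mL.
have L00 : lorenz0 L p0 0 = 0 by rewrite lorenz0_le.
have L01 : lorenz0 L p0 1 = 1.
  by rewrite lorenz0_ge ?ltW // L1 divff // subr_eq0 gt_eqF.
split=> //.
- move=> p /= pI; have := pI; rewrite !in_itv /= => /andP[p_ge0 p_le1].
  by rewrite -{1}L00 -L01 !mL0.
- move=> t x y; rewrite !inE /= => xI yI.
  have cM := convex_function_max _ _ _ _ _
    (convex_function_cst _ _ _ 0) (convex_function_subM _ _ _ _ (L p0) _ d0 cL).
  by rewrite !maxE ?conv01 //; apply: cM; rewrite inE.
Qed.

Theorem mainTheorem5 (R : realType) (L : R -> R) (n n0 : nat)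
    (data : n.-tuple R)
    (hL : genuine_lorenz L)
    (hn : (1 <= n)%N)
    (hdata : count_mem 0 data = n0)
    (hn0 : (n0 < n)%N) :
  genuine_lorenz (lorenz0 L (n0%:R / n%:R)).
Proof.
apply: lorenz0_genuine => //.
by rewrite ltr_pdivrMr ?ltr0n // mul1r ltr_nat.
Qed.
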